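(* Let $N$ be a finite set of players with $2\le \#N<\infty$, and let $\mathcal{G}=\{\Gamma(K) : K=1,2,\dots,\#N\}$ be a (nested) family of simultaneous coalition structure formation games $$\Gamma(K)=\Big\langle N,\ \{K,\mathcal{P}(K),\mathcal{R}(K)\},\ \big(S_i(K),\mathcal{U}_i(K)\big)_{i\in N}\Big\rangle .$$ Then the family $\mathcal{G}$ has an equilibrium in mixed strategies $\sigma^*(\mathcal{G})=(\sigma^*(1),\dots,\sigma^*(\#N))$. That is, for every $K\in\{1,\dots,\#N\}$ there is a mixed strategy profile $\sigma^*(K)=(\sigma_i^*(K))_{i\in N}$, with $\sigma^*_i(K)\in\Sigma_i(K)$ for every $i \in N$, such that for every player $i\in N$ and every $\sigma_i(K)\in\Sigma_i(K)$ with $\sigma_i(K)\neq\sigma_i^*(K)$, $$EU_i^{\Gamma(K)}\big(\sigma_i^*(K),\sigma_{-i}^*(K)\big)\ \ge\ EU_i^{\Gamma(K)}\big(\sigma_i(K),\sigma_{-i}^*(K)\big).$$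
   Context: **Partitions.** $N$ is a finite set of players, $2\le\#N<\infty$. For $K\in\{1,\dots,\#N\}$ (the maximum coalition size), $\mathcal{P}(K)$ is the set of all partitions (coalition structures) of $N$ into nonempty, pairwise disjoint coalitions of size at most $K$: $$\mathcal{P}(K)=\Big\{P=\{g_j\} : g_j\subset N,\ \#g_j\le K,\ \textstyle\bigcup_j g_j=N,\ g_{j_1}\cap g_{j_2}=\emptyset \text{ for } j_1\ne j_2\Big\}.$$ Thus $\mathcal{P}(1)\subset\dots\subset\mathcal{P}(\#N)$. **Strategies.** For each player $i$ and each partition $P$ there is a finite nonempty set $S_i(P)$ of individual strategies. Player $i$'s strategy set in $\Gamma(K)$ is the union $S_i(K)=\bigcup_{P\in\mathcal{P}(K)}S_i(P)$, where choosing an element means choosing a desired partition $P\in\mathcal{P}(K)$ together with an action for that partition (strategies attached to different partitions are regarded as distinct). The set of strategy profiles is $S(K)=\times_{i\in N}S_i(K)$. Thus $S_i(1)\subset\dots\subset S_i(\#N)$ and $S(1)\subset\dots\subset S(\#N)$. **Coalition structure formation mechanism.** For each $K$, a mechanism $\mathcal{R}(K)$ is given exogenously. It assigns to every profile $s\in S(K)$ exactly one final partition $P\in\mathcal{P}(K)$. Writing $S(P)\subset S(K)$ for the set of profiles to which $P$ is assigned (for the given $K$), one has $$S(K)=\bigcup_{P\in\mathcal{P}(K)}S(P),\qquad S(\bar P)\cap S(\tilde P)=\emptyset \text{ for } \bar P\neq\tilde P .$$ The set $S(P)$ need not be a direct product of sets, and in particular need not be $\times_{i\in N}S_i(P)$.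 The final partition need not coincide with a given player's desired partition. **Payoffs.** For each $K$, each $P\in\mathcal{P}(K)$ and each player $i$ there is a bounded payoff function $U_i(P):S(P)\to\mathbb{R}_+$, and $\mathcal{U}_i(K)=\{U_i(P):P\in\mathcal{P}(K)\}$. The payoff of player $i$ at $s\in S(K)$ is $U_i(s)=U_i(P)(s)$, where $P$ is the unique partition in $\mathcal{P}(K)$ with $s\in S(P)$. **Game and family.** These data constitute the game $\Gamma(K)$. The family $(\Gamma(K))_{K=1}^{\#N}$ is nested, $\Gamma(1)\subset\dots\subset\Gamma(\#N)$, meaning that all games have the same player set $N$ and all components are consistent: the partition families and strategy sets are nested as described, and for $K<\#N$ the mechanism $\mathcal{R}(K+1)$ and the payoffs in $\Gamma(K+1)$ agree on $S(K)\subset S(K+1)$ with the mechanism $\mathcal{R}(K)$ and the payoffs in $\Gamma(K)$. **Mixed strategies and expected utility.** $\Sigma_i(K)$ is the set of probability measures on the finite set $S_i(K)$. For a profile $(\sigma_i(K))_{i\in N}$, $\sigma_{-i}(K)=(\sigma_j(K))_{j\ne i}$; players randomize independently, and $$EU_i^{\Gamma(K)}(\sigma_i(K),\sigma_{-i}(K))=\int_{S(K)}U_i(s_i,s_{-i})\,d\sigma_i(K)\,d\sigma_{-i}(K)=\sum_{P\in\mathcal{P}(K)}\int_{S(P)}U_i(P)(s_i,s_{-i})\,d\sigma_i(K)\,d\sigma_{-i}(K).$$ *)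

(* Defs.v *)
From HB Require Import structures.
From mathcomp Require Import all_boot all_order all_algebra.
From mathcomp Require Import all_classical all_reals all_analysis.

Set Implicit Arguments.
Unset Strict Implicit.
Unset Printing Implicit Defensive.

Import Order.TTheory GRing.Theory Num.Theory.

Local Open Scope classical_set_scope.
Local Open Scope ring_scope.

Definition coalition_structure (N : finType) : Type :=
  {P : {set {set N}} | finset.partition P [set: N]%SET}.
HB.instance Definition _ N := Finite.on (coalition_structure N).

Definition structures (N : finType) (K : nat) : {set coalition_structure N} :=
  [set P : coalition_structure N | [forall g in val P, #|g| <= K]%N]%SET.

(* The sets S_i(P).  They do not depend on the maximum coalition size, which
   is what makes the strategy sets of the different games nested. *)
Record actions (N : finType) := Actions {
  action :> N -> coalition_structure N -> finType;
  action_nonempty : forall i P, (0 < #|action i P|)%N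
}.

(* Everything below is indexed by k, standing for the maximum coalition size
   K = k.+1; the sizes 1, ..., #N are thus k.+1 for k : 'I_#|N|. *)

(* S_i(K), as a subset of the disjoint union of the S_i(P) over all P. *)
Definition strategy (N : finType) (A : actions N) (k : nat) (i : N) : Type :=
  {a : {P : coalition_structure N & A i P} | tag a \in structures N k.+1}.
HB.instance Definition _ N (A : actions N) k i :=
  Finite.on (strategy A k i).

Definition profile (N : finType) (A : actions N) (k : nat) : Type :=
  {dffun forall i : N, strategy A k i}.
HB.instance Definition _ N (A : actions N) k := Finite.on (profile A k).

Record game (R : realType) (N : finType) (A : actions N) (k : nat) := Game {
  mechanism : profile A k -> {P | P \in structures N k.+1};
  (* U_i(P) has domain S(P) = {s | mechanism s = P}. *)
  utility : forall (i : N) (P : {P | P \in structures N k.+1}),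
    {s : profile A k | mechanism s == P} -> R;
  utility_ge0 : forall i P s, 0 <= @utility i P s;
  utility_bounded : forall i P, exists M, forall s, @utility i P s <= M
}.

Definition payoff R N (A : actions N) k (G : game R A k) (i : N)
    (s : profile A k) : R :=
  @utility _ _ _ _ G i (mechanism G s) (exist _ s (eqxx _)).

(* The hypothesis relating s and t says that they are the same profile, seen
   in S(K) and in S(K+1). *)
Record game_family (R : realType) (N : finType) (A : actions N) := GameFamily {
  game_at :> forall k : 'I_#|N|, game R A k;
  game_nested : forall k l : 'I_#|N|, l = k.+1 :> nat ->
    forall (s : profile A k) (t : profile A l),
    (forall i, val (s i) = val (t i)) ->
    val (mechanism (game_at k) s) = val (mechanism (game_at l) t) /\
    forall i, payoff (game_at k) i s = payoff (game_at l) i t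
}.

Section discrete_strategies.
Variables (N : finType) (A : actions N) (k : nat).

Let singletons : {set {set N}} := [set [set x] | x in N]%SET.

Let singletonsP : finset.partition singletons [set: N]%SET.
Proof.
apply/and3P; split.
- apply/eqP/setP => x; rewrite inE; apply/bigcupP; exists [set x]%SET.
    exact: imset_f.
  exact/set1P.
- apply/finset.trivIsetP => _ _ /imsetP[x _ ->] /imsetP[y _ ->] xy.
  rewrite disjoints1 inE; apply: contraNN xy => /eqP ->.
  by [].
- by apply/imsetP => -[x _ /setP/(_ x)]; rewrite !inE eqxx.
Qed.

Let P1 : coalition_structure N := exist _ singletons singletonsP.

Let P1_in : P1 \in structures N k.+1.
Proof.
rewrite inE; apply/forall_inP => g /imsetP[x _ ->].
by rewrite cards1.
Qed.

Let action0 i : A i P1 := enum_val (Ordinal (action_nonempty A i P1)).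

Let strategy0 i : strategy A k i :=
  exist _ (Tagged (fun P => A i P) (action0 i)) P1_in.

Let profile0 : profile A k := [ffun i => strategy0 i].

HB.instance Definition _ i := isPointed.Build (strategy A k i) (strategy0 i).
HB.instance Definition _ := isPointed.Build (profile A k) profile0.

HB.instance Definition _ i := @isMeasurable.Build default_measure_display
  (strategy A k i) discrete_measurable discrete_measurable0
  discrete_measurableC discrete_measurableU.
HB.instance Definition _ := @isMeasurable.Build default_measure_display
  (profile A k) discrete_measurable discrete_measurable0
  discrete_measurableC discrete_measurableU.

End discrete_strategies.

Definition mixed_strategy (R : realType) N (A : actions N) k (i : N) : Type :=
  probability (strategy A k i) R.

Definition mixed_profile (R : realType) N (A : actions N) k : Type :=
  forall i : N, mixed_strategy R A k i.

Lemma sum_dffun_prod (R : comNzRingType) (I : finType) (T : I -> finType)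
    (w : forall i, T i -> R) :
  \sum_(f : {dffun forall i, T i}) \prod_i w i (f i) =
  \prod_i \sum_(x : T i) w i x.
Proof.
rewrite (reindex (@dffun_of_fprod _ T)); last first.
  exact/onW_bij/dffun_of_fprod_bij.
pose w' i : {ffun T i -> R} := [ffun x => w i x].
transitivity (\sum_(t : fprod T) \prod_(i in I) w' i (t i)).
  by apply: eq_bigr => t _; apply: eq_bigr => i _; rewrite !ffunE.
rewrite big_fprod; transitivity
    (\prod_i \sum_(j in tagged_with T i) untag 0 (w' i) j).
  by rewrite bigA_distr_big_dep.
apply: eq_bigr => i _.
by rewrite -(big_tag w'); apply: eq_bigr => x _; rewrite ffunE.
Qed.

Lemma strategy_measureE (R : realType) N (A : actions N) k (i : N)
    (mu : mixed_strategy R A k i) (B : set (strategy A k i)) :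
  fine (mu B) = \sum_x fine (mu [set x]) * \1_B x.
Proof.
have {1}-> : B = \bigcup_(x in [set: strategy A k i]) ([set x] `&` B).
  by apply/seteqP; split => [x Bx|x [_ _ []]//]; exists x.
rewrite measure_fin_bigcup//; first last.
- apply/trivIsetP => x y _ _ /eqP xy.
  by apply/seteqP; split => // z [[/= -> _] [/xy]].
- exact: finite_finset.
have -> : [set: strategy A k i] = [set` index_enum (strategy A k i)].
  by apply/seteqP; split => x //= _; rewrite mem_index_enum.
rewrite -fsbig_seq ?index_enum_uniq// -sum_fine//=; last first.
  by move=> x _; exact: fin_num_measure.
apply: eq_bigr => x _; rewrite indicE; case: (boolP (x \in B)) => [|/negP] xB.
  rewrite mulr1 (_ : _ `&` _ = [set x])//; apply/seteqP; split => [y []//|].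
  by move=> _ /= ->; split => //; exact/set_mem.
rewrite mulr0 (_ : _ `&` _ = set0) ?measure0//; apply/seteqP; split => // y.
by case=> /= -> /mem_set.
Qed.

Section independent_play.
Variables (R : realType) (N : finType) (A : actions N) (k : nat).
Variable sigma : mixed_profile R A k.

(* The product measure: it is discrete, with the product of the individual
   probabilities as its density (see independent_play_rectangle). *)
Definition independent_play (B : set (profile A k)) : \bar R :=
  (\sum_(s : profile A k | s \in B) (\prod_i fine (sigma i [set s i]))%:E)%E.

Let weight (s : profile A k) : R := \prod_i fine (sigma i [set s i]).

Let weight_ge0 s : 0 <= weight s.
Proof. by apply: prodr_ge0 => i _; exact: fine_ge0. Qed.

Lemma independent_play_rectangle (B : forall i, set (strategy A k i)) :
  independent_play [set s : profile A k | forall i, B i (s i)] =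
  (\prod_i fine (sigma i (B i)))%:E.
Proof.
under eq_bigr do rewrite strategy_measureE.
rewrite -(sum_dffun_prod (fun i x => fine (sigma i [set x]) * \1_(B i) x)).
rewrite /independent_play sumEFin big_mkcond/=; congr (_%:E).
apply: eq_bigr => s _; rewrite big_split/=.
case: ifPn => [/set_mem /= sB|/negP sB].
  by rewrite [X in _ * X]big1 ?mulr1// => i _; rewrite indicE mem_set.
have [i /negP Bi] : exists i, ~ s i \in B i.
  apply/existsNP => sB'; apply: sB; apply/mem_set => i /=.
  exact/set_mem/sB'.
by rewrite [X in _ * X](bigD1 i)//= indicE (negbTE Bi) mul0r mulr0.
Qed.

Let independent_play_setT : independent_play [set: profile A k] = 1%E.
Proof.
rewrite (_ : [set: _] = [set s : profile A k | forall i, setT (s i)]).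
  rewrite (independent_play_rectangle (fun=> setT)) big1// => i _.
  by rewrite probability_setT.
by apply/seteqP; split.
Qed.

Let independent_play0 : independent_play set0 = 0%E.
Proof. by rewrite /independent_play big_pred0// => s; rewrite in_set0. Qed.

Let independent_play_ge0 B : (0 <= independent_play B)%E.
Proof. by apply: sume_ge0 => s _; rewrite lee_fin weight_ge0. Qed.

Let independent_play_sigma_additive : semi_sigma_additive independent_play.
Proof.
pose s_ (n : nat) : profile A k := nth point (enum {: profile A k}) n.
pose mu := msum (fun n => mscale (NngNum (weight_ge0 (s_ n))) (\d_(s_ n)))
  #|{: profile A k}|.
suff -> : independent_play = mu by exact: measure_semi_sigma_additive.
apply/funext => B.
rewrite /independent_play big_mkcond/= /mu /msum/=.
rewrite (_ : index_enum _ = enum {: profile A k}); last by rewrite enumT.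
rewrite (big_nth point) big_mkord -cardE.
apply: eq_bigr => n _; rewrite /mscale/= diracE.
by case: ifP => _; rewrite ?mule1 ?mule0.
Qed.

HB.instance Definition _ := isMeasure.Build _ _ _ independent_play
  independent_play0 independent_play_ge0 independent_play_sigma_additive.
HB.instance Definition _ := Measure_isProbability.Build _ _ _
  independent_play independent_play_setT.

End independent_play.

Definition expected_utility (R : realType) N (A : actions N) k
    (G : game R A k) (i : N) (sigma : mixed_profile R A k) : R :=
  \int[independent_play sigma]_s payoff G i s.

(* dfwith sigma i tau replaces the strategy of player i in sigma by tau. *)
Definition equilibrium (R : realType) N (A : actions N) k
    (G : game R A k) (sigma : mixed_profile R A k) : Prop :=
  forall (i : N) (tau : mixed_strategy R A k i), tau <> sigma i ->
  expected_utility G i (dfwith sigma i tau) <= expected_utility G i sigma.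

Definition family_equilibrium (R : realType) N (A : actions N)
    (G : game_family R A)
    (sigma : forall k : 'I_#|N|, mixed_profile R A k) : Prop :=
  forall k, equilibrium (G k) (sigma k).

(* Main.v *)
Require Import Defs.
From HB Require Import structures.
From mathcomp Require Import all_boot all_order all_algebra.
From mathcomp Require Import zify lra.

(** Each game of the family is a finite game in normal form, so the theorem is
Nash's existence theorem, applied to each size [k] separately; how a mechanism
turns a profile into a partition only enters through the real number that it
pays to each player.

Nash's theorem is derived here without a fixed point theorem, from a covering
property of the simplex [D] of probability vectors on a finite set [I]
([closed_cover_simplex]): if closed sets [A i], [i] in [I], cover [D], then
some [x] in [D] belongs to [A i] for each [i] in its support.  To use it, let
[I] be the disjoint union of the strategy sets of all the players.  A point
[x] of [D] gives each player a nonnegative vector, of total mass [mass x i],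
and the payoffs extend multilinearly to such vectors.  Let [A (i, a)] be the
set of the [x] at which player [i] has the least mass and the pure strategy
[a] is a best reply of [i].  These sets are closed, and they cover [D].  At the
point [x] provided by the covering property, each player of positive mass has
the least mass, so all the masses are equal; and each pure strategy of
positive weight is a best reply.  Multiplying [x] by the number of players
makes each player's vector a probability vector, and it multiplies all the
payoffs of a given player by the same positive constant: this is a Nash
equilibrium ([support_optimal], [nash]).

The covering property comes from Scarf's combinatorial lemma
([scarf]): if the points of a finite set are compared by finitely many
functions [h i] and each point is labelled by one of the indices, then there
is a set [Z] of points such that every point [y] satisfies [h i y <= h i x] for
all [x] in [Z], for some label [i] occurring in [Z].  When the points are
those of a fine grid in [D], the [h i] are the coordinates and the label of a
point is an index [i] such that [A i] contains it, the points of [Z] are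
close to each other, and their coordinates are small outside the set of labels
of [Z] ([scarf_grid]).  Compactness does the rest.  Scarf's lemma itself is a
parity argument in the style of Sperner's lemma, for which the orders provide
the incidence structure, so that no triangulation is needed
([dominant_rainbow]).

Expected payoffs are integrals; on finite sets they are sums, and a
vector of weights is the same thing as a probability measure
([expected_utilityE], [mixed_strategy_of_weights]). *)

Set Implicit Arguments.
Unset Strict Implicit.
Unset Printing Implicit Defensive.

(** * Scarf's lemma *)

Section Collision.
Variables (aT rT : finType) (f : aT -> rT).
Implicit Types Z : {set aT}.

Lemma imset_setD1_collision Z x y : x \in Z -> y \in Z -> x != y -> f x = f y ->
  f @: (Z :\ x) = f @: Z.
Proof.
move=> xZ yZ xy fxy; apply/eqP; rewrite eqEsubset imsetS ?subD1set//=.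
apply/subsetP => _ /imsetP[z zZ ->]; have [->|zx] := eqVneq z x.
  by rewrite fxy imset_f// in_setD1 eq_sym xy.
by rewrite imset_f// in_setD1 zx.
Qed.

(** When [f] identifies exactly one pair of points of [Z], those two points are
the ones that can be removed without changing the image.  Both halves of the
parity argument rest on this count. *)
Lemma card_collision Z : #|Z| = #|f @: Z|.+1 ->
  #|[set z in Z | f @: (Z :\ z) == f @: Z]| = 2.
Proof.
move=> cZ; have /dinjectivePn[x xZ [y /andP[/= yx yZ] fxy]] : ~~ dinjectiveb f Z.
  by apply/dinjectiveP => /imset_injP; rewrite cZ; lia.
have xy : x != y by rewrite eq_sym.
suff -> : [set z in Z | f @: (Z :\ z) == f @: Z] = [set x; y].
  by rewrite cards2 xy.
apply/setP => z; rewrite !inE; apply/andP/orP => [[zZ /eqP fz]|]; last first.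
  case=> /eqP ->; split => //.
    by rewrite (imset_setD1_collision xZ yZ).
  by rewrite (imset_setD1_collision yZ xZ).
apply/orP; rewrite -[_ || _]negbK negb_or; apply/negP => /andP[zx zy].
have xZz : x \in Z :\ z by rewrite !inE eq_sym zx.
have yZz : y \in Z :\ z by rewrite !inE eq_sym zy.
have := imset_setD1_collision xZz yZz xy fxy; rewrite fz => fzx.
have := leq_imset_card f (Z :\ z :\ x); rewrite fzx.
by have := cardsD1 x (Z :\ z); have := cardsD1 z Z; rewrite xZz zZ; lia.
Qed.

End Collision.

Section Scarf.
Variables (X I : finType) (r : I -> X -> nat).
Implicit Types (Z W : {set X}) (i j k l : I) (x y z w : X).

Definition below i y Z := [forall z in Z, r i y <= r i z].

(** No point beats [Z] strictly in all the orders at once.  The dominant sets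
with as many elements as there are orders are Scarf's primitive sets: they
play the role of the cells of a triangulation. *)
Definition dominant Z := [forall y, exists i, below i y Z].

Lemma belowP i y Z : reflect {in Z, forall z, r i y <= r i z} (below i y Z).
Proof. exact: forall_inP. Qed.

Lemma dominantP Z :
  reflect (forall y, exists i, {in Z, forall z, r i y <= r i z}) (dominant Z).
Proof.
apply: (iffP forallP) => domZ y.
  by have /existsP[i /belowP] := domZ y; exists i.
by have [i ?] := domZ y; apply/existsP; exists i; apply/belowP.
Qed.

Lemma dominantS W Z : W \subset Z -> dominant Z -> dominant W.
Proof.
move=> /subsetP WZ /dominantP domZ; apply/dominantP => y.
by have [i iy] := domZ y; exists i => z /WZ; exact: iy.
Qed.

Hypothesis r_inj : forall i, injective (r i).

(** These are Scarf's slack vectors, to be thought of as the vertices of a very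
large simplex around all the other points.  Because of them, the only faces
on the boundary of the structure are those whose points are all slack. *)
Variable s : I -> X.
Hypothesis s_min : forall i x, r i (s i) <= r i x.
Hypothesis s_max : forall i j x, i != j -> x \notin codom s -> r i x < r i (s j).

(** An inner face [W] of codimension one lies in exactly two cells.  Let [m i]
be the point of [W] that is least in the order [i].  As [W] has one point
less than there are orders, exactly two orders share the same least
point; these are the two orders in [K].  The two cells are obtained by
choosing [k] in [K], looking at the region [M k] of the points that are above
the least point of [W] in each order other than [k], and adding to [W] the
point of this region that is largest in the order [k]. *)
Lemma card_cofaces W w : w \in W -> w \notin codom s -> dominant W ->
  #|W|.+1 = #|I| -> #|[set x | (x \notin W) && dominant (x |: W)]| = 2.
Proof.
move=> wW wNs /dominantP domW cW.
pose m i := [arg min_(z < w in W) r i z].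
have mW i : m i \in W by rewrite /m; case: arg_minnP.
have mle i z : z \in W -> r i (m i) <= r i z.
  by rewrite /m; case: arg_minnP => // x _ /(_ z) /[apply].
have mT : m @: setT = W.
  apply/eqP; rewrite eqEsubset; apply/andP; split.
    by apply/subsetP => _ /imsetP[i _ ->].
  apply/subsetP => z zW; have [i iz] := domW z; apply/imsetP; exists i => //.
  by apply: (@r_inj i); apply/anti_leq; rewrite iz// mle.
pose K := [set k in setT | m @: (setT :\ k) == m @: setT].
have cK : #|K| = 2 by apply: card_collision; rewrite mT cardsT cW.
have KP k : k \in K -> forall z, z \in W -> exists2 l, l != k & z = m l.
  rewrite !inE mT => /andP[_ /eqP mk] z; rewrite -mk => /imsetP[l].
  by rewrite !inE andbT; exists l.
pose M k := [set y | [forall l, (l != k) ==> (r l (m l) < r l y)]].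
have MP k y : reflect (forall l, l != k -> r l (m l) < r l y) (y \in M k).
  rewrite inE; apply: (iffP forallP) => h l; first exact/implyP.
  by apply/implyP; exact: h.
(* As [w] is not slack, the slack point [s k] is above it in each order other
   than [k]: the region is nonempty. *)
have sM k : s k \in M k.
  apply/MP => l lk; apply: leq_ltn_trans (mle l _ wW) _; exact: s_max.
have MK k y : k \in K -> y \in M k -> y \notin W.
  move=> kK /MP yM; apply/negP => /(KP _ kK)[l lk ym].
  by have := yM _ lk; rewrite ym ltnn.
have M_below k y : y \in M k -> r k y <= r k (m k).
  move=> /MP yM; have [l /(_ _ (mW l)) ly] := domW y.
  have [<-//|/yM] := eqVneq l k; by rewrite ltnNge ly.
pose phi k := [arg max_(y > s k in M k) r k y].
have phiM k : phi k \in M k by rewrite /phi; case: arg_maxnP.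
have phi_max k y : y \in M k -> r k y <= r k (phi k).
  by rewrite /phi; case: arg_maxnP => // x _ /(_ y) /[apply].
rewrite -cK; have <- : #|phi @: K| = #|K|.
  apply: card_in_imset => k k' _ _ phikk'; apply/eqP/negP => /negP kk'.
  have [l /(_ _ (mW l)) ly] := domW (phi k).
  have [lk|/(MP _ _ (phiM k))] := eqVneq l k; last by rewrite ltnNge ly.
  have lk' : l != k' by rewrite lk.
  by have := MP _ _ (phiM k') _ lk'; rewrite -phikk' ltnNge ly.
congr #|pred_of_set _|; apply/setP => x; rewrite inE.
apply/andP/imsetP => [[xW /dominantP domx]|[k kK ->]]; last first.
  split; first exact: (MK k).
  apply/dominantP => y; have [yM|] := boolP (y \in M k).
    exists k => z /setU1P[->|zW]; first exact: phi_max.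
    exact: leq_trans (M_below _ _ yM) (mle _ _ zW).
  rewrite inE negb_forall => /existsP[l]; rewrite negb_imply -leqNgt.
  move=> /andP[lk yl]; exists l => z /setU1P[->|zW].
    exact: leq_trans yl (ltnW (MP _ _ (phiM k) _ lk)).
  exact: leq_trans yl (mle _ _ zW).
(* Conversely, if adding [x] gives a dominant set, then [x] is the least point
   of that set in some order [k]. *)
have [k kx] := domx x.
have kW z : z \in W -> r k x <= r k z by move=> zW; apply/kx/setU1r.
have hit z : z \in W -> exists2 l, z = m l & r l z < r l x.
  move=> zW; have [l lz] := domx z; exists l.
    apply: (@r_inj l); apply/anti_leq; rewrite (mle _ _ zW) lz//.
    exact: setU1r.
  rewrite ltn_neqAle lz ?setU11// andbT; apply: contraNneq xW.
  by move/r_inj <-.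
have kNl z l : z \in W -> r l z < r l x -> l != k.
  by move=> zW; rewrite ltnNge; apply: contraNneq => ->; exact: kW.
have kK : k \in K.
  rewrite !inE mT /= eqEsubset; apply/andP; split.
    by apply/subsetP => _ /imsetP[i _ ->].
  apply/subsetP => z zW; have [l zm lx] := hit _ zW.
  by apply/imsetP; exists l => //; rewrite !inE andbT (kNl z).
(* If [x] were the least point in a second order [l], the remaining orders
   would be too few for all the points of [W] to be least in one of them. *)
have xM : x \in M k.
  apply/MP => l lk; rewrite ltnNge; apply/negP => lx.
  have : W \subset m @: (setT :\ k :\ l).
    apply/subsetP => z zW; have [l' zm l'x] := hit _ zW.
    apply/imsetP; exists l' => //; rewrite !inE andbT (kNl z)//.
    rewrite andbT; apply: contraTneq l'x => ->; rewrite -leqNgt.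
    exact: leq_trans lx (mle _ _ zW).
  move=> /subset_leq_card; have := leq_imset_card m (setT :\ k :\ l).
  have := cardsD1 l (setT :\ k); have := cardsD1 k setT.
  rewrite !inE lk cardsT -cW /=; lia.
exists k => //; apply: (@r_inj k); apply/anti_leq; rewrite phi_max//=.
have [l lphi] := domx (phi k).
have lx := lphi x (setU11 _ _).
have [lk|lk] := eqVneq l k; first by move: lx; rewrite lk.
have := lphi (m l) (setU1r _ (mW l)).
by rewrite leqNgt (MP _ _ (phiM k) _ lk).
Qed.

Variable c : X -> I.
Hypothesis sK : cancel s c.
Variable x0 : X.
Hypothesis x0Ns : x0 \notin codom s.

Let s_inj : injective s := can_inj sK.

Lemma dominant_slacks i x : x \notin codom s ->
  (forall y, y \notin codom s -> r i y <= r i x) ->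
  dominant (x |: s @: [set~ i]).
Proof.
move=> xNs x_max; apply/dominantP => y.
have [/codomP[j ->]|yNs] := boolP (y \in codom s).
  by exists j => z _; exact: s_min.
exists i => z /setU1P[->|/imsetP[j ji ->]]; first exact: x_max.
by apply/ltnW/s_max => //; rewrite !inE eq_sym in ji.
Qed.

(** A boundary face lies in one cell only: the added point must be the largest
nonslack point in the order [i], because the set of all the slack points is
not dominant. *)
Lemma card_cofaces_slacks i :
  #|[set x | (x \notin s @: [set~ i]) && dominant (x |: s @: [set~ i])]| = 1.
Proof.
pose xM := [arg max_(x > x0 | x \notin codom s) r i x].
have [xMNs xM_max] : xM \notin codom s /\
    forall y, y \notin codom s -> r i y <= r i xM.
  by rewrite /xM; case: arg_maxnP.
rewrite (_ : [set x | _] = [set xM]) ?cards1//; apply/setP => x; rewrite !inE.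
apply/andP/eqP => [[xW /dominantP domx]|->]; last first.
  split; last exact: dominant_slacks.
  by apply: contraNN xMNs => /imsetP[j _ ->]; exact: codom_f.
have slackN j y : y \notin codom s -> ~ r j y <= r j (s j).
  move=> yNs yj; case/negP: yNs; suff -> : y = s j by exact: codom_f.
  by apply: (@r_inj j); apply/anti_leq; rewrite yj s_min.
have [xs|xNs] := boolP (x \in codom s).
  have [j jx] := domx xM; have [] := slackN j _ xMNs.
  apply: jx; have [->|ji] := eqVneq j i; last first.
    by apply/setU1r/imset_f; rewrite !inE.
  case/codomP: xs xW => k -> skW; suff -> : i = k by exact: setU11.
  by apply/eqP/negP => /negP ik; case/negP: skW; rewrite imset_f// !inE eq_sym.
have [j jx] := domx xM; have [ji|ji] := eqVneq j i.
  apply: (@r_inj i); apply/anti_leq; rewrite xM_max//= -ji.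
  exact/jx/setU11.
by have [] := slackN j _ xMNs; apply/jx/setU1r/imset_f; rewrite !inE.
Qed.

(** Sperner's double counting.  Fix a label [i0].  A door is a dominant set with
one point less than there are orders and whose labels are all those
different from [i0]; a room is a cell which has at least these labels.  If no
room had all the labels, then each room would have two doors.  But each door
is in two rooms, except for the door made of slack points, which is in
one room; so the number of incidences would be both even and odd. *)
Theorem dominant_rainbow : exists Z, dominant Z /\ c @: Z = setT.
Proof.
have [[Z /andP[domZ /eqP cZ]]|noZ] :=
  altP (@existsP _ (fun Z => dominant Z && (c @: Z == setT))).
  by exists Z.
have {}noZ Z : dominant Z -> c @: Z != setT.
  move=> domZ; apply: contraNneq noZ => cZ.
  by apply/existsP; exists Z; rewrite domZ cZ/=.
pose i0 := c x0; pose W0 := s @: [set~ i0].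
pose door W := [&& dominant W, #|W|.+1 == #|I| & c @: W == [set~ i0]].
pose room Z := [&& dominant Z, #|Z| == #|I| & [set~ i0] \subset c @: Z].
have roomE Z : room Z -> c @: Z = [set~ i0].
  move=> /and3P[domZ _ sZ]; apply/eqP; rewrite eq_sym eqEcard sZ cardsC1.
  have := noZ Z domZ; rewrite -properT => /proper_card; rewrite cardsT; lia.
have cI : #|I| = #|[set~ i0]|.+1.
  by rewrite cardsC1 prednK//; apply/card_gt0P; exists i0.
have doorW0 : door W0.
  apply/and3P; split.
  - pose xM := [arg max_(x > x0 | x \notin codom s) r i0 x].
    apply: (@dominantS _ (xM |: W0)); first exact: subsetUr.
    by apply: dominant_slacks; rewrite /xM; case: arg_maxnP.
  - by rewrite card_imset// cI.
  - rewrite -imset_comp; apply/eqP.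
    by rewrite (eq_imset (g := id)) ?imset_id//; exact: sK.
have doorN W : door W -> W != W0 -> exists2 w, w \in W & w \notin codom s.
  move=> /and3P[_ _ /eqP cW] WW0; apply/exists_inP; apply: contraNT WW0.
  rewrite negb_exists_in => /forall_inP Ws; apply/eqP/setP => w.
  apply/idP/imsetP => [wW|[i iN ->]].
    have /negPn/codomP[i wi] := Ws _ wW; exists i => //.
    by rewrite -cW -(sK i) -wi imset_f.
  move: iN; rewrite -cW => /imsetP[w' w'W ->].
  by have /negPn/codomP[i' w'i] := Ws _ w'W; rewrite w'i sK -w'i.
pose cofaces W := #|[set x | (x \notin W) && dominant (x |: W)]|.
pose faces Z := #|[set z in Z | c @: (Z :\ z) == c @: Z]|.
(* Both sides count the pairs of a door and a room that contains it, given by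
   the door and the point that it lacks. *)
have count : \sum_(W | door W) cofaces W = \sum_(Z | room Z) faces Z.
  rewrite /cofaces /faces; under eq_bigr do rewrite -sum1dep_card.
  under [RHS]eq_bigr do rewrite -sum1dep_card.
  rewrite !pair_big_dep/=.
  rewrite (reindex_onto (fun p => (p.1 :\ p.2, p.2))
                        (fun p => (p.2 |: p.1, p.2))).
    apply: eq_bigl => -[Z z] /=.
    rewrite xpair_eqE eqxx andbT setD11 /=.
    have [zZ|zZ] := boolP (z \in Z); last first.
      rewrite andbF andbC; case: eqP => // zZE.
      by move: zZ; rewrite -zZE setU11.
    rewrite setD1K// eqxx andbT/=; apply/andP/andP => [[]|[roomZ]].
      move=> /and3P[_ cZ /eqP cZz] domZ.
      have roomZ : room Z.
        by rewrite /room domZ -cZz imsetS ?subD1set// andbT (cardsD1 z) zZ.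
      by rewrite roomZ cZz roomE.
    rewrite (roomE Z)// => cZz; case/and3P: (roomZ) => domZ cZ _; split => //.
    rewrite /door cZz (dominantS (subD1set _ _) domZ) -(eqP cZ).
    by rewrite [X in _ == X](cardsD1 z) zZ eqxx.
  by move=> [W x] /= /andP[_ /andP[xW _]]; rewrite setU1K.
have : \sum_(Z | room Z) faces Z = #|room| * 2.
  rewrite -sum_nat_const; apply: eq_bigr => Z roomZ; apply: card_collision.
  by rewrite roomE//; case/and3P: roomZ => _ /eqP -> _.
have : \sum_(W | door W) cofaces W =
    1 + #|[pred W | door W && (W != W0)]| * 2.
  rewrite (bigD1 W0)//= /cofaces card_cofaces_slacks; congr (_ + _)%N.
  rewrite -sum_nat_const; apply: eq_bigr => W /andP[doorW WW0].
  have [w wW wNs] := doorN _ doorW WW0.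
  by case/and3P: doorW => domW /eqP cW _; exact: card_cofaces wW wNs _ _.
rewrite count => ->; lia.
Qed.

End Scarf.

(** The slack points are added as the right summand of [T + I], and ties
between points of [T] are broken by rank.  If a point [y] of [T] is below all
the points of the dominant set in the order [i], then the slack point of [i] is
not in that set, because [y] is above it in this order; so the label [i]
is carried by a point of [T]. *)
Lemma scarf (T I : finType) (h : I -> T -> nat) (c : T -> I) (t0 : T) :
  exists Z : {set T}, forall y,
    exists2 i, i \in c @: Z & {in Z, forall x, h i y <= h i x}.
Proof.
have T_gt0 : 0 < #|T| by apply/card_gt0P; exists t0.
pose rho i t := h i t * #|T| + enum_rank t.
have rho_inj i : injective (rho i).
  move=> t t' /(congr1 (modn^~ #|T|)); rewrite !modnMDl !modn_small//.
  by move=> /val_inj/enum_rank_inj.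
have rho_h i t : rho i t %/ #|T| = h i t.
  by rewrite divnMDl// divn_small ?addn0.
pose B := \max_(p : I * T) rho p.1 p.2.
have rhoB i t : rho i t <= B by exact: (leq_bigmax (i, t)).
pose r i (z : T + I) := match z with
  | inl t => (rho i t).+1
  | inr j => if i == j then 0 else B + (enum_rank j).+2 end.
pose c' (z : T + I) := match z with inl t => c t | inr j => j end.
have inlNs t : inl t \notin codom (@inr T I) by apply/codomP => -[].
have [|i|i j [t|k]||Z [/dominantP domZ cZ]] :=
    @dominant_rainbow (T + I)%type I r _ inr _ _ c' _ (inl t0) (inlNs t0).
- move=> i [t|j] [t'|j'] //=; rewrite ?addnS.
  + by case=> /rho_inj ->.
  + by case: eqP => // _ [] rB; have := rhoB i t; lia.
  + by case: eqP => // _ [] rB; have := rhoB i t'; lia.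
  + by do 2![case: eqP => [<-|_]] => // -[] /addnI/val_inj/enum_rank_inj ->.
- by move=> z; rewrite /r eqxx.
- by move=> /negPf ij _; rewrite /r ij; have := rhoB i t; lia.
- by move=> ij; rewrite codom_f.
- by [].
exists [set t | inl t \in Z] => y; have [i iy] := domZ (inl y).
exists i => [|x]; last first.
  by rewrite inE => /iy/=; rewrite ltnS => /(leq_div2r #|T|); rewrite !rho_h.
have : i \in c' @: Z by rewrite cZ.
case/imsetP => -[t tZ ->|j jZ ij]; first by apply: imset_f; rewrite inE.
by have := iy _ jZ; rewrite /= ij eqxx.
Qed.

(** * Scarf's lemma on a grid of the simplex *)

(** The points of the simplex whose coordinates are multiples of [1 / M],
scaled by [M]. *)
Definition grid (I : finType) (M : nat) : Type :=
  {t : {ffun I -> 'I_M.+1} | \sum_i t i == M}.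
HB.instance Definition _ I M := Finite.on (grid I M).

Lemma grid_of_sum (I : finType) (M : nat) (y : I -> nat) :
  \sum_i y i = M -> exists t : grid I M, forall i, val t i = y i :> nat.
Proof.
move=> yM.
have y_le i : y i < M.+1 by rewrite ltnS -yM (bigD1 i)//= leq_addr.
pose t : {ffun I -> 'I_M.+1} := [ffun i => Ordinal (y_le i)].
have tM : \sum_i t i == M.
  by apply/eqP; rewrite -[RHS]yM; apply: eq_bigr => i _; rewrite ffunE.
by exists (exist _ t tM) => i; rewrite /= ffunE.
Qed.

Lemma leq_sum_gap (I : finType) (P : pred I) (f g : I -> nat) i :
  P i -> (forall j, P j -> f j <= g j) ->
  g i + \sum_(j | P j) f j <= f i + \sum_(j | P j) g j.
Proof.
move=> Pi fg; rewrite !(bigD1 i Pi) addnCA leq_add2l leq_add2l.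
by apply: leq_sum => j /andP[/fg].
Qed.

(** Let [C] be the set of labels of [Z], and [lo] the coordinatewise minimum of
[Z].  If the sum of [lo i + 1] over [C] were at most [M], some grid point would
be larger than [lo] in each coordinate of [C], against Scarf's lemma.  So
the coordinates of [lo] in [C] already nearly sum to [M], which leaves room
for less than [#|C|] units of difference in each coordinate. *)
Lemma scarf_grid (I : finType) (M : nat) (c : grid I M -> I) : 0 < #|I| ->
  exists Z : {set grid I M}, [/\ Z != set0,
    forall (z z' : grid I M) i, z \in Z -> z' \in Z ->
      val z i <= val z' i + #|I| &
    forall (z : grid I M) i, z \in Z -> i \notin c @: Z -> val z i < #|I|].
Proof.
case/card_gt0P => i0 _.
have [t0 _] : exists t : grid I M,
    forall i, val t i = (if i == i0 then M else 0) :> nat.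
  by apply: grid_of_sum; rewrite -big_mkcond big_pred1_eq.
have [Z Zdom] := scarf (fun i (t : grid I M) => val t i : nat) c t0.
have [_ /imsetP[z0 z0Z ->] _] := Zdom t0.
pose lo i : nat := val [arg min_(z < z0 in Z) val z i] i.
have lo_le (z : grid I M) i : z \in Z -> lo i <= val z i.
  by rewrite /lo; case: arg_minnP => // x _ /(_ z) /[apply].
set C := c @: Z in Zdom *.
have cz0 : c z0 \in C by exact: imset_f.
have M_lt : M < \sum_(i in C) (lo i).+1.
  rewrite ltnNge; apply/negP => loM.
  pose y i := (if i \in C then (lo i).+1 else 0) +
    (if i == c z0 then M - \sum_(i in C) (lo i).+1 else 0).
  have /grid_of_sum[t tE] : \sum_i y i = M.
    by rewrite big_split/= -!big_mkcond/= big_pred1_eq subnKC.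
  have [i iC ylo] := Zdom t.
  have [z zZ zlo] : exists2 z, z \in Z & val z i = lo i :> nat.
    by exists [arg min_(z < z0 in Z) val z i] => //; case: arg_minnP.
  by have := ylo _ zZ; rewrite tE zlo /y iC; lia.
have {}M_lt : M < \sum_(i in C) lo i + #|C|.
  by move: M_lt; under eq_bigr do rewrite -addn1; rewrite big_split/= sum1_card.
have sumC (z : grid I M) :
    \sum_(i in C) val z i + \sum_(i | i \notin C) val z i = M.
  have /eqP := valP z; by rewrite (bigID [in C]).
have CI : #|C| <= #|I| by exact: max_card.
have sum_lo (z : grid I M) :
    z \in Z -> \sum_(i in C) lo i <= \sum_(i in C) val z i.
  by move=> zZ; apply: leq_sum => j _; exact: lo_le.
have inC (z : grid I M) i : z \in Z -> i \in C -> val z i < lo i + #|I|.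
  move=> zZ iC.
  have := leq_sum_gap (P := fun j => j \in C) iC (fun j _ => lo_le z j zZ).
  by have := sumC z; lia.
have outC (z : grid I M) i : z \in Z -> i \notin C -> val z i < #|I|.
  move=> zZ iC; have := sumC z; have := sum_lo z zZ.
  have : val z i <= \sum_(j | j \notin C) val z j.
    by rewrite (bigD1 i iC) leq_addr.
  by lia.
exists Z; split; first by apply/set0Pn; exists z0.
- move=> z z' i zZ z'Z; have [iC|iC] := boolP (i \in C).
    by have := inC _ _ zZ iC; have := lo_le z' i z'Z; lia.
  by have := outC _ _ zZ iC; lia.
- exact: outC.
Qed.

(** * Closed covers of the simplex *)

From mathcomp Require Import all_classical all_reals all_analysis.
From mathcomp Require Import measurable_realfun.

Import Order.TTheory GRing.Theory Num.Theory.
Import numFieldNormedType.Exports.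

Local Open Scope classical_set_scope.
Local Open Scope ring_scope.

Lemma ptws_cvg (U : Type) (V : topologicalType) (F : set_system {ptws U -> V})
    (f : U -> V) : Filter F ->
  (forall t, (fun g : U -> V => g t) @ F --> f t) -> {ptws, F --> f}.
Proof.
move=> FF Ff; apply/cvg_sup => i.
rewrite cvg_image; last first.
  by apply/seteqP; split=> v // _; exists (cst v).
move=> W /= /Ff FW; exists ((fun g => g i) @^-1` W) => //.
by apply/seteqP; split => [_ [g Wg <-]//|v Wv]; exists (cst v).
Qed.

Lemma continuous_sum (R : realType) (J : Type) (r : seq J) (P : pred J)
    (T : topologicalType) (F : J -> T -> R) : (forall j, P j -> continuous (F j)) ->
  continuous (fun x => \sum_(j <- r | P j) F j x).
Proof. by move=> cF; apply: continuous_big => //; exact: add_continuous. Qed.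

Lemma closed_le_continuous (R : realType) (T : topologicalType) (f g : T -> R) :
  continuous f -> continuous g -> closed [set x | f x <= g x].
Proof.
move=> cf cg; rewrite (_ : [set x | _] = (g \- f) @^-1` [set y | 0 <= y]).
  by apply: preimage_closed => // x _; apply: cvgB; [exact: cg|exact: cf].
by apply/seteqP; split => x /=; rewrite subr_ge0.
Qed.

Lemma continuousM_cst (R : realType) (T : topologicalType) (k : R) (f : T -> R) :
  continuous f -> continuous (fun x => k * f x).
Proof. by move=> cf x; apply: cvgM; [exact: cvg_cst|exact: cf]. Qed.

Lemma continuous_prod (R : realType) (J : Type) (r : seq J) (P : pred J)
    (T : topologicalType) (F : J -> T -> R) :
  (forall j, P j -> continuous (F j)) ->
  continuous (fun x => \prod_(j <- r | P j) F j x).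
Proof. by move=> cF; apply: continuous_big => //; exact: mul_continuous. Qed.

Section Simplex.
Variables (R : realType) (I : finType).

Definition simplex : set {ptws I -> R} :=
  [set x | (forall i, 0 <= x i) /\ \sum_i x i = 1].

Lemma continuous_coord i : continuous (fun x : {ptws I -> R} => x i).
Proof. exact: (@proj_continuous I (fun=> R) i). Qed.

Lemma simplex_compact : compact simplex.
Proof.
pose cube := [set x : {ptws I -> R} | forall i, `[0, 1]%classic (x i)].
apply: (@subclosed_compact _ _ cube).
- rewrite (_ : simplex =
    \bigcap_i (fun x : {ptws I -> R} => x i) @^-1` [set y | 0 <= y] `&`
    (fun x : {ptws I -> R} => \sum_i x i) @^-1` [set y | y = 1]).
    apply: closedI.
      apply: closed_bigI => i _; apply: preimage_closed => // x _.
      exact: continuous_coord.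
    apply: preimage_closed => // x _; apply: continuous_sum => // i _.
    exact: continuous_coord.
  by apply/seteqP; split => x [x0 x1]; split => // i; [move=> _|]; apply: x0.
- apply: (@tychonoff I (fun=> R) (fun=> `[0, 1]%classic)) => i.
  exact: segment_compact.
- move=> x [x0 x1] i; rewrite /= in_itv/= x0/= -x1 (bigD1 i)//= lerDl.
  by apply: sumr_ge0 => j _; exact: x0.
Qed.

Lemma nbhs_ptws (x : {ptws I -> R}) e : 0 < e ->
  nbhs x [set y : {ptws I -> R} | forall i, `|y i - x i| < e].
Proof.
move=> e0; have near_i i : nbhs x [set y : {ptws I -> R} | `|y i - x i| < e].
  have /cvgrPdist_lt /(_ e e0) := @continuous_coord i x.
  by apply: filterS => y; rewrite distrC.
have := @filter_forall _ _ _ (nbhs x) _ near_i.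
exact.
Qed.

Lemma closed_ptws_approx (A : set {ptws I -> R}) (x : {ptws I -> R}) :
  closed A ->
  (forall e, 0 < e -> exists2 z, A z & forall i, `|z i - x i| <= e) -> A x.
Proof.
move=> cA Ax.
have /choice[z zP] : forall n : nat, exists z,
    A z /\ forall i, `|z i - x i| <= n.+1%:R^-1.
  by move=> n; have [|z Az zx] := Ax n.+1%:R^-1; [rewrite invr_gt0|exists z].
apply: (@closed_cvg _ _ \oo _ z A cA _ x); first by apply: nearW => n; case: (zP n).
apply: (@ptws_cvg _ _ (z @ \oo)) => i.
suff: (fun n => z n i) @ \oo --> x i by [].
apply/cvgrPdist_lt => e e0; near=> n; rewrite distrC.
apply: le_lt_trans (proj2 (zP n) i) _.
by near: n; exact: (near_infty_natSinv_lt (PosNum e0)).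
Unshelve. all: by end_near. Qed.

(** The covering property up to an error that the mesh of the grid makes small.
The label of a grid point is an index of a set that contains it. *)
Lemma approximate_rainbow (A : I -> set {ptws I -> R}) (M : nat) :
  (forall x, simplex x -> exists i, A i x) -> (0 < #|I|)%N -> (0 < M)%N ->
  exists2 x, simplex x & forall i, #|I|%:R / M%:R < x i ->
    exists2 z, A i z & forall j, `|z j - x j| <= #|I|%:R / M%:R.
Proof.
move=> covA I0 M0; have M0' : 0 < M%:R :> R by rewrite ltr0n.
pose pt (t : grid I M) : {ptws I -> R} := fun i => (val t i)%:R / M%:R.
have pt_simplex t : simplex (pt t).
  split=> [i|]; first by rewrite divr_ge0// ler0n.
  by rewrite -mulr_suml -natr_sum (eqP (valP t)) divff// gt_eqF.
have /choice[c cP] : forall t, exists i, A i (pt t) by move=> t; exact/covA.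
have [Z [/set0Pn[z0 z0Z] near_Z small_Z]] := scarf_grid c I0.
exists (pt z0) => // i; rewrite ltr_pM2r ?invr_gt0// ltr_nat => Ilt.
have /imsetP[z zZ iE] : i \in c @: Z.
  by apply: contraTT Ilt => /(small_Z _ _ z0Z); rewrite -leqNgt => /ltnW.
exists (pt z); first by rewrite iE; exact: cP.
move=> j; rewrite -mulrBl normrM [`|M%:R^-1|]gtr0_norm ?invr_gt0//.
rewrite ler_pM2r ?invr_gt0// ler_norml.
have := near_Z z z0 j zZ z0Z; have := near_Z z0 z j z0Z zZ.
by rewrite -!(ler_nat R) !natrD; lra.
Qed.

(** A companion of the Knaster-Kuratowski-Mazurkiewicz lemma: nothing is
required of the cover on the boundary, and the point found belongs to the sets
that its support names instead of to all of them.  It is a cluster point of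
the approximate solutions on finer and finer grids. *)
Theorem closed_cover_simplex (A : I -> set {ptws I -> R}) : (0 < #|I|)%N ->
  (forall i, closed (A i)) -> (forall x, simplex x -> exists i, A i x) ->
  exists2 x, simplex x & forall i, 0 < x i -> A i x.
Proof.
move=> I0 cA covA.
have /choice[x xP] : forall n : nat, exists x, simplex x /\
    forall i, #|I|%:R / n.+1%:R < x i ->
    exists2 z, A i z & forall j, `|z j - x j| <= #|I|%:R / n.+1%:R.
  by move=> n; have [//|x sx xP] := @approximate_rainbow A n.+1 covA I0; exists x.
have [p [sp px]] : simplex `&` cluster (x @ \oo) !=set0.
  apply: (@simplex_compact (x @ \oo)); exists 0%N => // n _.
  exact: proj1 (xP n).
exists p => // i pi_gt0; apply: closed_ptws_approx => // e e0.
(* [d <= p i / 2] keeps coordinate [i] of the approximations above their error. *)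
pose d := Num.min (e / 2) (p i / 2).
have d0 : 0 < d by rewrite lt_min !divr_gt0.
have I0' : 0 < #|I|%:R :> R by rewrite ltr0n.
have dI0 : 0 < d / #|I|%:R by rewrite divr_gt0.
have [N _ NP] := near_infty_natSinv_lt (PosNum dI0).
have xN : (x @ \oo) [set x n | n in [set n | (N <= n)%N]].
  by exists N => // n /= Nn; exists n.
have [_ [[n /= Nn <-] nearp]] := px _ _ xN (nbhs_ptws p d0).
have {NP}small : #|I|%:R / n.+1%:R < d.
  by rewrite mulrC -ltr_pdivlMr//; exact: NP.
have [de dp] : d <= e / 2 /\ d <= p i / 2 by rewrite !ge_min !lexx orbT.
have [z Az zx] : exists2 z, A i z & forall j, `|z j - x n j| <= #|I|%:R / n.+1%:R.
  apply: (proj2 (xP n)); apply: lt_trans small _.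
  by have := nearp i; rewrite ltr_norml => /andP[]; lra.
exists z => // j; rewrite -(subrKA (x n j)); apply: le_trans (ler_normD _ _) _.
rewrite [leRHS]splitr; apply: lerD; last exact: ltW (lt_le_trans (nearp j) de).
exact: le_trans (zx j) (le_trans (ltW small) de).
Qed.

End Simplex.

(** * Nash equilibria of finite games *)

Section Nash.
Variables (R : realType) (N : finType) (S : N -> finType).
Variable u : N -> {dffun forall i, S i} -> R.
Hypothesis S_gt0 : forall i, (0 < #|S i|)%N.
Hypothesis N_gt0 : (0 < #|N|)%N.
Implicit Types w : forall i, S i -> R.

(** The payoff of [i] for playing [a] against the vectors [w j], extended
multilinearly to vectors which need not sum to one. *)
Definition pure_payoff w i (a : S i) : R :=
  \sum_(s : {dffun forall i, S i} | s i == a) u i s * \prod_(j | j != i) w j (s j).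

Lemma pure_payoffZ k w i (a : S i) :
  pure_payoff (fun j b => k * w j b) a =
  k ^+ #|[pred j | j != i]| * pure_payoff w a.
Proof.
rewrite /pure_payoff mulr_sumr; apply: eq_bigr => s _.
by rewrite big_split/= prodr_const mulrCA.
Qed.

(** The points of the simplex over [J] give a vector to each player. *)
Let J := {i : N & S i}.
Let wt (x : J -> R) i (a : S i) : R := x (Tagged S a).
Let mass (x : J -> R) i : R := \sum_(a : S i) wt x a.

Lemma continuous_mass i : continuous (fun x : {ptws J -> R} => mass x i).
Proof.
by apply: continuous_sum => a _; exact: continuous_coord.
Qed.

Lemma continuous_pure_payoff i (a : S i) :
  continuous (fun x : {ptws J -> R} => pure_payoff (wt x) a).
Proof.
rewrite /pure_payoff; apply: continuous_sum => s _.
apply: continuousM_cst; apply: continuous_prod => j _.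
exact: continuous_coord.
Qed.

(** The covering property, applied to the sets [A (i, a)] where [i] has
the least mass and [a] is a best reply of [i]. *)
Lemma support_optimal : exists w, [/\ forall i a, 0 <= w i a,
    forall i, \sum_a w i a = 1 &
    forall i (a b : S i), 0 < w i a -> pure_payoff w b <= pure_payoff w a].
Proof.
pose A (p : J) : set {ptws J -> R} :=
  (\bigcap_j [set x | mass x (tag p) <= mass x j]) `&`
  (\bigcap_(b in [set: S (tag p)])
     [set x | pure_payoff (wt x) b <= pure_payoff (wt x) (tagged p)]).
have cA p : closed (A p).
  apply: closedI; apply: closed_bigI => j _; apply: closed_le_continuous;
    by [exact: continuous_mass|exact: continuous_pure_payoff].
have [i0 _] := card_gt0P N_gt0.
have a0 i : S i by exact: enum_val (Ordinal (S_gt0 i)).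
have J_gt0 : (0 < #|{: J}|)%N by apply/card_gt0P; exists (Tagged S (a0 i0)).
have covA (x : {ptws J -> R}) : simplex x -> exists p, A p x.
  move=> _; pose i := [arg min_(j < i0) mass x j]%O.
  pose a := [arg max_(b > a0 i) pure_payoff (wt x) b]%O.
  exists (Tagged S a); split => /=.
    by move=> j _ /=; rewrite /i; case: arg_minP => // k _; apply.
  by move=> b _ /=; rewrite /a; case: arg_maxP => // c _; apply.
have [x [x_ge0 x1] xA] := closed_cover_simplex J_gt0 cA covA.
have massE : \sum_i mass x i = 1.
  by rewrite -x1 sig_big_dep/=; apply: eq_bigr => -[].
have mass_min i j : 0 < mass x i -> mass x i <= mass x j.
  move=> mi; have [a a_gt0] : exists a : S i, 0 < wt x a.
    apply/existsP; rewrite -[[exists _, _]]negbK negb_exists.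
    apply: contraTN mi => /forallP wle; rewrite -leNgt.
    by apply: sumr_le0 => a _; rewrite leNgt.
  by have [+ _] := xA (Tagged S a) a_gt0; apply.
have [i1 mi1] : exists i, 0 < mass x i.
  apply/existsP; rewrite -[[exists _, _]]negbK negb_exists.
  apply/negP => /forallP mle.
  have : \sum_i mass x i <= 0 by apply: sumr_le0 => i _; rewrite leNgt.
  by rewrite massE ler10.
have mass_const i : mass x i = mass x i1.
  apply/le_anti; rewrite [X in _ && X]mass_min// mass_min//.
  exact: lt_le_trans mi1 (mass_min _ _ mi1).
have N0 : 0 < #|N|%:R :> R by rewrite ltr0n.
have NE : #|N|%:R * mass x i1 = 1.
  rewrite -[RHS]massE (eq_bigr _ (fun i _ => mass_const i)).
  by rewrite sumr_const mulr_natl.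
exists (fun i a => #|N|%:R * wt x a); split => [i a|i|i a b].
- by rewrite mulr_ge0//; exact: x_ge0.
- by rewrite -mulr_sumr -/(mass x i) mass_const.
- rewrite pmulr_rgt0// => wa; rewrite !pure_payoffZ ler_pM2l ?exprn_gt0//.
  by have [_] := xA (Tagged S a) wa; apply.
Qed.

Theorem nash : exists w, [/\ forall i a, 0 <= w i a,
    forall i, \sum_a w i a = 1 &
    forall i (v : S i -> R), (forall a, 0 <= v a) -> \sum_a v a = 1 ->
      \sum_a v a * pure_payoff w a <= \sum_a w i a * pure_payoff w a].
Proof.
have [w [w_ge0 w1 w_opt]] := support_optimal.
exists w; split => // i v v_ge0 v1.
have [a wa] : exists a, 0 < w i a.
  apply/existsP; rewrite -[[exists _, _]]negbK negb_exists.
  apply/negP => /forallP wle.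
  have : \sum_a w i a <= 0 by apply: sumr_le0 => a _; rewrite leNgt.
  by rewrite w1 ler10.
have -> : \sum_b w i b * pure_payoff w b = pure_payoff w a.
  rewrite -[RHS]mul1r -(w1 i) mulr_suml; apply: eq_bigr => b _.
  have [->|wb] := eqVneq (w i b) 0; first by rewrite !mul0r.
  have {}wb : 0 < w i b by rewrite lt_def wb w_ge0.
  by congr (_ * _); apply/le_anti; rewrite !w_opt.
rewrite -[leRHS]mul1r -v1 mulr_suml; apply: ler_sum => b _.
by rewrite ler_wpM2l// w_opt.
Qed.

End Nash.

(** * Mixed strategies and expected payoffs as finite sums *)

Section PointMasses.
Context d (T : measurableType d) (R : realType) (J : finType) (j0 : J).
Variables (p : J -> T) (w : J -> {nonneg R}).

(** Written as a sum over an initial segment of the naturals, [j0] being the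
value of the enumeration beyond its end, because [msum] is a measure. *)
Definition point_masses : set T -> \bar R :=
  msum (fun n => let j := nth j0 (enum J) n in mscale (w j) (\d_(p j))) #|J|.

HB.instance Definition _ := Measure.on point_masses.

Lemma sum_nth_enum (F : J -> \bar R) :
  (\sum_(n < #|J|) F (nth j0 (enum J) n) = \sum_j F j)%E.
Proof.
by rewrite -[RHS]big_enum (big_nth j0) big_mkord -cardE.
Qed.

Lemma point_massesE A : (point_masses A = \sum_j (w j)%:num%:E * \d_(p j) A)%E.
Proof. exact: (sum_nth_enum (fun j => (w j)%:num%:E * \d_(p j) A)%E). Qed.

Lemma integral_point_masses (f : T -> \bar R) :
  (forall x, (0 <= f x)%E) -> measurable_fun setT f ->
  (\int[point_masses]_x f x = \sum_j (w j)%:num%:E * f (p j))%E.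
Proof.
move=> f_ge0 mf; rewrite ge0_integral_measure_sum//.
rewrite -(sum_nth_enum (fun j => (w j)%:num%:E * f (p j))%E).
apply: eq_bigr => n _; rewrite ge0_integral_mscale// integral_dirac//.
by rewrite diracT mul1e.
Qed.

Hypothesis w1 : \sum_j (w j)%:num = 1.

Lemma point_masses_setT : point_masses setT = 1%E.
Proof.
rewrite point_massesE -[RHS]/((1:R)%:E) -w1 -sumEFin; apply: eq_bigr => j _.
by rewrite diracT mule1.
Qed.

End PointMasses.

Section ExpectedUtility.
Variables (R : realType) (N : finType) (A : actions N) (k : nat).
Variable G : game R A k.

Lemma mixed_strategy_of_weights i (w : strategy A k i -> R) :
  (forall a, 0 <= w a) -> \sum_a w a = 1 ->
  exists mu : mixed_strategy R A k i, forall a, fine (mu [set a]) = w a.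
Proof.
move=> w_ge0 w1.
pose mu := point_masses (point : strategy A k i) id (fun a => NngNum (w_ge0 a)).
have mu1 : mu setT = 1%E by exact: point_masses_setT.
pose muP : mixed_strategy R A k i :=
  HB.pack mu (Measure_isProbability.Build _ _ _ mu mu1).
exists muP => a; transitivity (fine (mu [set a])) => //.
rewrite /mu point_massesE (bigD1 a)//= big1 => [|b ba].
  by rewrite adde0 diracE mem_set// mule1.
by rewrite diracE memNset ?mule0//= => ab; rewrite ab eqxx in ba.
Qed.

Lemma payoff_ge0 i s : 0 <= payoff G i s.
Proof. exact: utility_ge0. Qed.

Lemma expected_utilityE i (sigma : mixed_profile R A k) :
  expected_utility G i sigma =
  \sum_s payoff G i s * \prod_j fine (sigma j [set s j]).
Proof.
have w_ge0 (s : profile A k) : 0 <= \prod_j fine (sigma j [set s j]).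
  by apply: prodr_ge0 => j _; exact: fine_ge0.
rewrite /expected_utility /Rintegral.
rewrite (eq_measure_integral
  (point_masses (point : profile A k) id (fun s => NngNum (w_ge0 s)))).
  rewrite integral_point_masses//.
  - by rewrite -sum_fine//=; apply: eq_bigr => s _; rewrite mulrC.
  - by move=> s; rewrite lee_fin payoff_ge0.
move=> B _ _; apply: etrans; last exact/esym/point_massesE.
rewrite /= /independent_play big_mkcond/=.
by apply: eq_bigr => s _; rewrite diracE; case: ifP; rewrite ?mule1 ?mule0.
Qed.

Let weights (sigma : mixed_profile R A k) i (a : strategy A k i) : R :=
  fine (sigma i [set a]).

Lemma sum_weights i (mu : mixed_strategy R A k i) :
  \sum_a fine (mu [set a]) = 1.
Proof.
have := strategy_measureE mu setT; rewrite probability_setT /= => ->.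
by apply: eq_bigr => a _; rewrite indicT mulr1.
Qed.

Lemma expected_utility_pure i (sigma : mixed_profile R A k) :
  expected_utility G i sigma =
  \sum_(a : strategy A k i)
     weights sigma a * pure_payoff (payoff G) (weights sigma) a.
Proof.
rewrite expected_utilityE (partition_big (fun s : profile A k => s i) xpredT)//=.
apply: eq_bigr => a _; rewrite /pure_payoff mulr_sumr.
apply: eq_bigr => s /eqP sa.
by rewrite (bigD1 i)//= mulrCA sa.
Qed.

Lemma expected_utility_deviation i (sigma : mixed_profile R A k)
    (tau : mixed_strategy R A k i) :
  expected_utility G i (dfwith sigma i tau) =
  \sum_(a : strategy A k i)
     fine (tau [set a]) * pure_payoff (payoff G) (weights sigma) a.
Proof.
rewrite expected_utility_pure; apply: eq_bigr => a _.
rewrite /weights dfwithin; congr (_ * _).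
apply: eq_bigr => s _; congr (_ * _); apply: eq_bigr => j ji.
by rewrite dfwithout// eq_sym.
Qed.

Theorem equilibrium_exists : (0 < #|N|)%N ->
  exists sigma : mixed_profile R A k, equilibrium G sigma.
Proof.
move=> N_gt0.
have S_gt0 i : (0 < #|{: strategy A k i}|)%N.
  by apply/card_gt0P; exists point.
have [w [w_ge0 w1 w_best]] := nash (payoff G) S_gt0 N_gt0.
pose sigma : mixed_profile R A k :=
  fun i => sval (cid (mixed_strategy_of_weights (w_ge0 i) (w1 i))).
have sigmaE : weights sigma = w.
  apply/functional_extensionality_dep => i; apply/funext => a.
  by rewrite /weights /sigma; case: cid.
exists sigma => i tau _.
rewrite expected_utility_deviation expected_utility_pure sigmaE.
by apply: w_best; [move=> a; exact: fine_ge0|exact: sum_weights].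
Qed.

End ExpectedUtility.

Theorem theorem1 (R : realType) (N : finType) (hN : (2 <= #|N|)%N)
    (A : actions N) (G : game_family R A) :
  exists sigma : forall k : 'I_#|N|, mixed_profile R A k,
    family_equilibrium G sigma.
Proof.
have N_gt0 : (0 < #|N|)%N by exact: leq_trans hN.
exists (fun k => sval (cid (equilibrium_exists (G k) N_gt0))) => k.
by case: cid.
Qed.
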